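(* For $k>0$ and $c\in\mathbb{R}$ let $\{p[k,c]_n(x)\}_{n\ge 0}$ be the orthogonal polynomial sequence given by $p[k,c]_0(x)=1$, $p[k,c]_1(x)=x-b_0$ and $p[k,c]_{n+1}(x)=(x-b_n)\,p[k,c]_n(x)-\lambda_n\,p[k,c]_{n-1}(x)$ for $n\ge 1$, where $$b_n=2c(k+n)\quad\text{and}\quad \lambda_n=n(n+2k-1).$$ Then for any $k>0$, $m\in\mathbb{N}$ and $c\in\mathbb{R}$, the matrix entry $\langle e_0,(\pi_k^+(-C)+c\cdot\pi_k^+(H)+\pi_k^+(B))^me_0\rangle$ is the $m$th moment of the functional (normalized to take the value $1$ at the constant polynomial $1$) associated to $\{p[k,c]_n(x)\}_{n\ge 0}$. Similarly, the matrix entry $\langle e_0,(\pi_k^-(-C)+c\cdot\pi_k^-(H)+\pi_k^-(B))^me_0\rangle$ is the $m$th moment of the functional (with the same normalization) associated to $\{p[k,-c]_n(x)\}_{n\ge 0}$.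
   Context: The Lie algebra $su(1,1)$ has generators $H,B,C$ with commutation relations $[H,B]=2B$, $[H,C]=-2C$, $[B,C]=H$. Its positive and negative discrete series representations $\pi_k^+$ and $\pi_k^-$ ($k>0$) act on $\ell^2(\mathbb{Z}_{\ge 0})$ with orthonormal basis $\{e_n\}_{n\ge 0}$ by $$\pi_k^+(H)e_n=2(k+n)e_n,\quad \pi_k^+(B)e_n=\sqrt{(n+1)(2k+n)}\,e_{n+1},\quad \pi_k^+(C)e_n=-\sqrt{n(2k+n-1)}\,e_{n-1},$$ $$\pi_k^-(H)e_n=-2(k+n)e_n,\quad \pi_k^-(B)e_n=-\sqrt{n(2k+n-1)}\,e_{n-1},\quad \pi_k^-(C)e_n=\sqrt{(n+1)(2k+n)}\,e_{n+1},$$ where terms with $e_{-1}$ are zero. A sequence of polynomials $\{p_n(x)\}_{n\ge 0}$ with $\deg p_n=n$ is an orthogonal polynomial sequence with associated moment functional $f$ if $f:\mathbb{C}[x]\to\mathbb{C}$ is a linear form such that $f(p_m(x)p_n(x))=0$ for $m\ne n$ and $f(p_n(x)^2)\ne 0$ for all $n$; $f$ is determined up to a nonzero constant factor. The $m$th moment is $f(x^m)$. *)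

(* Defs.v *)
From HB Require Import structures.
From mathcomp Require Import all_boot all_order all_algebra.
From mathcomp Require Import finmap reals.
From mathcomp Require Import complex.
From mathcomp.multinomials Require Import monalg.

Set Implicit Arguments.
Unset Strict Implicit.
Unset Printing Implicit Defensive.

Import Order.TTheory GRing.Theory Num.Theory.
Local Open Scope ring_scope.
Local Open Scope complex_scope.

Section SU11.
Variable K : comNzRingType.

(* Coordinates (h, b, c) stand for h H + b B + c C.  For K = R[i] this is the
   complexification of the real Lie algebra. *)
Definition su11 : lmodType K := 'rV[K]_3.

Definition gH : su11 := delta_mx 0 0.
Definition gB : su11 := delta_mx 0 1.
Definition gC : su11 := delta_mx 0 2%:R.

Definition coefH (X : su11) : K := (X : 'rV[K]_3) 0 0.
Definition coefB (X : su11) : K := (X : 'rV[K]_3) 0 1.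
Definition coefC (X : su11) : K := (X : 'rV[K]_3) 0 2%:R.

Definition bracket (X Y : su11) : su11 :=
    (coefB X * coefC Y - coefC X * coefB Y) *: gH
  + (2%:R * (coefH X * coefB Y - coefB X * coefH Y)) *: gB
  - (2%:R * (coefH X * coefC Y - coefC X * coefH Y)) *: gC.

Lemma bracket_HB : bracket gH gB = 2%:R *: gB.
Proof.
by rewrite /bracket /coefH /coefB /coefC !mxE /= !(mulr0, mul0r, mulr1, subr0,
   oppr0, scale0r, add0r, addr0).
Qed.

Lemma bracket_HC : bracket gH gC = - (2%:R *: gC).
Proof.
by rewrite /bracket /coefH /coefB /coefC !mxE /= !(mulr0, mul0r, mulr1, subr0,
   oppr0, scale0r, add0r, addr0).
Qed.

Lemma bracket_BC : bracket gB gC = gH.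
Proof.
by rewrite /bracket /coefH /coefB /coefC !mxE /= !(mulr0, mul0r, mulr1, subr0,
   oppr0, scale0r, addr0, scale1r).
Qed.

End SU11.

Arguments gH {K}.
Arguments gB {K}.
Arguments gC {K}.

Section FinitelySupported.
Variable K : numClosedFieldType.

(* The representing operators are unbounded on l^2(N); they live on the linear
   span of the orthonormal basis, i.e. the finitely supported sequences, which
   they map to itself and on which their products are computed. *)
Definition l2fin : lmodType K := {malg K[nat]}.

Definition e (n : nat) : l2fin := << n >>.

(* e_(n-1), with the convention e_(-1) = 0 *)
Definition e_pred (n : nat) : l2fin := if n is n'.+1 then e n' else 0.

(* The inner product of l^2(N), restricted to finitely supported sequences. *)
Definition inner (u v : l2fin) : K := \sum_(n <- msupp u) (u@_n)^* * v@_n.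

(* The linear operator that maps e n to g n. *)
Definition linext (g : nat -> l2fin) (v : l2fin) : l2fin :=
  \sum_(n <- msupp v) v@_n *: g n.

Lemma linextEw (d : {fset nat}) g (v : l2fin) : (msupp v `<=` d)%fset ->
  linext g v = \sum_(n <- d) v@_n *: g n.
Proof.
move=> sub; rewrite /linext (big_fset_incl _ sub) // => n _.
by move/mcoeff_outdom => ->; rewrite scale0r.
Qed.

Lemma linext_is_linear g : linear (linext g).
Proof.
move=> a u v; pose d := (msupp u `|` msupp v)%fset.
rewrite !(@linextEw d) ?fsubsetUl ?fsubsetUr //; last first.
  apply: (fsubset_trans (msuppD_le _ _)).
  by apply: fsetUSS; [exact: msuppZ_le | exact: fsubset_refl].
rewrite scaler_sumr -big_split /=; apply: eq_bigr => n _.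
by rewrite mcoeffD mcoeffZ scalerDl scalerA.
Qed.

HB.instance Definition _ g :=
  GRing.isLinear.Build K l2fin l2fin _ (linext g) (linext_is_linear g).

Lemma linext_e g n : linext g (e n) = g n.
Proof.
by rewrite (@linextEw [fset n]%fset) ?msuppU_le // big_seq_fset1 mcoeffUU
   scale1r.
Qed.

(* The linear map su11 -> End(l2fin) given by the images of H, B and C. *)
Definition extend_gens (TH TB TC : l2fin -> l2fin) (X : su11 K) :
    l2fin -> l2fin :=
  fun v => coefH X *: TH v + coefB X *: TB v + coefC X *: TC v.

Lemma extend_gensH TH TB TC v : extend_gens TH TB TC gH v = TH v.
Proof.
by rewrite /extend_gens /coefH /coefB /coefC !mxE /= scale1r !scale0r !addr0.
Qed.

Lemma extend_gensB TH TB TC v : extend_gens TH TB TC gB v = TB v.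
Proof.
by rewrite /extend_gens /coefH /coefB /coefC !mxE /= scale1r !scale0r addr0
   add0r.
Qed.

Lemma extend_gensC TH TB TC v : extend_gens TH TB TC gC v = TC v.
Proof.
by rewrite /extend_gens /coefH /coefB /coefC !mxE /= scale1r !scale0r !add0r.
Qed.

(* <e_0, T^m e_0> *)
Definition matrix_entry (T : l2fin -> l2fin) (m : nat) : K :=
  inner (e 0) (iter m T (e 0)).

End FinitelySupported.

Section DiscreteSeries.
Variables (R : realType) (k : R).
Notation V := (l2fin R[i]).

Definition pi_pos : su11 R[i] -> V -> V := extend_gens
  (linext (fun n => (2%:R * (k + n%:R))%:C *: e _ n))
  (linext (fun n =>
     (Num.sqrt ((n%:R + 1) * (2%:R * k + n%:R)))%:C *: e _ n.+1))
  (linext (fun n =>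
     - ((Num.sqrt (n%:R * (2%:R * k + n%:R - 1)))%:C *: e_pred _ n))).

Definition pi_neg : su11 R[i] -> V -> V := extend_gens
  (linext (fun n => - ((2%:R * (k + n%:R))%:C *: e _ n)))
  (linext (fun n =>
     - ((Num.sqrt (n%:R * (2%:R * k + n%:R - 1)))%:C *: e_pred _ n)))
  (linext (fun n =>
     (Num.sqrt ((n%:R + 1) * (2%:R * k + n%:R)))%:C *: e _ n.+1)).

End DiscreteSeries.

(* pi (- C) + c pi (H) + pi (B) *)
Definition jacobi_op (R : realType)
    (pi : su11 R[i] -> l2fin R[i] -> l2fin R[i]) (c : R) :
    l2fin R[i] -> l2fin R[i] :=
  fun v => pi (- gC) v + c%:C *: pi gH v + pi gB v.

Section OrthogonalPolynomials.
Variable F : fieldType.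

Definition is_moment_functional (p : nat -> {poly F}) (f : {scalar {poly F}}) :=
  (forall m n : nat, m <> n -> f (p m * p n) = 0) /\
  (forall n : nat, f (p n ^+ 2) <> 0).

(* "the" functional of p: the one normalised by f 1 = 1. *)
Definition is_normalized_moment_functional (p : nat -> {poly F})
    (f : {scalar {poly F}}) := is_moment_functional p f /\ f 1 = 1.

Definition is_orthogonal_sequence (p : nat -> {poly F}) :=
  (forall n : nat, size (p n) = n.+1) /\
  (exists f : {scalar {poly F}}, is_moment_functional p f).

(* lambda 0 is not used. *)
Fixpoint three_term (b lambda : nat -> F) (n : nat) : {poly F} :=
  match n with
  | 0 => 1
  | n'.+1 =>
    match n' with
    | 0 => 'X - (b 0)%:P
    | n''.+1 => ('X - (b n')%:P) * three_term b lambda n'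
                - (lambda n') *: three_term b lambda n''
    end
  end.

End OrthogonalPolynomials.

Definition pkc (R : realType) (k c : R) : nat -> {poly R[i]} :=
  three_term (fun n => (2%:R * c * (k + n%:R))%:C)
             (fun n => (n%:R * (n%:R + 2%:R * k - 1))%:C).

(* Main.v *)
Require Import Defs.
From HB Require Import structures.
From mathcomp Require Import all_boot all_order all_algebra.
From mathcomp Require Import reals complex.
From mathcomp Require Import finmap ring.
From mathcomp.multinomials Require Import monalg.

(** The operator pi(-C) + c pi(H) + pi(B) is a symmetric tridiagonal (Jacobi)
    matrix T in the basis e_n, with diagonal b_n and off-diagonal entries
    s_n between e_(n-1) and e_n, where s_n ^ 2 = lambda_n; for the negative
    series the diagonal changes sign, which is the substitution c -> - c, and
    so do the s_n, which lambda_n does not see.  Hence the argument is one about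
    Jacobi matrices.

    Let a polynomial q act through q(T).  The three-term recurrence says
    exactly that p_n(T) e_0 = (s_1 ... s_n) e_n ([poly_act_three_term_e0]), and
    dually that the e_0 coordinate of p_n(T) e_j is s_1 ... s_n if j = n and
    0 otherwise ([poly_act_three_term_coef0]).  So the functional
    L(q) = <e_0, q(T) e_0> satisfies L(p_m p_n) = 0 for m <> n and
    L(p_n ^ 2) = (s_1 ... s_n) ^ 2, which is nonzero because lambda_n > 0 for
    n >= 1.  Finally any normalized moment functional f agrees with L on every
    p_n (both are 1 on p_0 = 1 and vanish on the p_n = p_n p_0 with n > 0), and
    the p_n span the polynomials because deg p_n = n; thus f = L, and L('X^m)
    is the matrix entry <e_0, T^m e_0>. *)

Set Implicit Arguments.
Unset Strict Implicit.
Unset Printing Implicit Defensive.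

Import Order.TTheory GRing.Theory Num.Theory.
Local Open Scope ring_scope.
Local Open Scope complex_scope.

(** * Polynomial sequences with one polynomial in each degree *)

Section PolynomialSequences.
Variable F : fieldType.
Implicit Types (b lambda : nat -> F) (p : nat -> {poly F}).

Lemma three_termSS b lambda n :
  three_term b lambda n.+2 =
    ('X - (b n.+1)%:P) * three_term b lambda n.+1
    - lambda n.+1 *: three_term b lambda n.
Proof. by []. Qed.

Lemma size_three_term b lambda n : size (three_term b lambda n) = n.+1.
Proof.
suff [] : size (three_term b lambda n) = n.+1 /\
          size (three_term b lambda n.+1) = n.+2 by [].
elim: n => [|n [IHn IHn1]]; first by rewrite size_poly1 size_XsubC.
split=> //; rewrite three_termSS.
have size_lead :
    size (('X - (b n.+1)%:P) * three_term b lambda n.+1) = n.+3.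
  by rewrite size_monicM ?monicXsubC -?size_poly_eq0 ?IHn1 // size_XsubC.
rewrite size_polyDl // size_lead size_polyN.
by apply: leq_ltn_trans (size_scale_leq _ _) _; rewrite IHn.
Qed.

(** A sequence with deg p_n = n spans the polynomials. *)
Lemma scalar_eq_on_basis p (f g : {scalar {poly F}}) :
  (forall n, size (p n) = n.+1) -> (forall n, f (p n) = g (p n)) -> f =1 g.
Proof.
move=> sizep fgp q.
have [n le_q_n] : exists n, (size q <= n)%N by exists (size q).
elim: n q le_q_n => [|n IHn] q le_q_n.
  by move: le_q_n; rewrite leqn0 size_poly_eq0 => /eqP ->; rewrite !linear0.
have lead_neq0 : (p n)`_n != 0.
  by rewrite -[X in _`_X]/(n.+1.-1) -(sizep n) -lead_coefE lead_coef_eq0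
             -size_poly_eq0 sizep.
(* Subtracting the right multiple of p_n kills the coefficient of 'X^n. *)
pose a := q`_n / (p n)`_n.
have /IHn eq_fg : (size (q - a *: p n)%R <= n)%N.
  apply/leq_sizeP => j; rewrite leq_eqVlt => /predU1P [<-|lt_n_j].
    by rewrite coefB coefZ /a divfK ?subrr.
  rewrite coefB coefZ !nth_default ?mulr0 ?subrr ?sizep //.
  exact: leq_trans le_q_n lt_n_j.
by move: eq_fg; rewrite !linearB !linearZ /= fgp => /addIr.
Qed.

Lemma normalized_moment_functional_uniq p (f g : {scalar {poly F}}) :
  (forall n, size (p n) = n.+1) -> p 0%N = 1 ->
  is_normalized_moment_functional p f ->
  is_normalized_moment_functional p g -> f =1 g.
Proof.
move=> sizep p0 [[f_orth _] f1] [[g_orth _] g1].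
apply: (scalar_eq_on_basis sizep) => -[|n]; first by rewrite p0 f1 g1.
by rewrite -[p n.+1]mulr1 -p0 f_orth ?g_orth.
Qed.

End PolynomialSequences.

(** * Polynomials in a linear operator *)

Section PolynomialAction.
Variables (K : fieldType) (V : lmodType K).
Implicit Types (p q : {poly K}) (v : V).

(** [poly_act T q v] is q(T) v. *)
Definition poly_act (T : V -> V) q v : V :=
  \sum_(i < size q) q`_i *: iter i T v.

Lemma poly_act_widen T q v n :
  (size q <= n)%N -> poly_act T q v = \sum_(i < n) q`_i *: iter i T v.
Proof.
move=> le_q_n; rewrite /poly_act.
rewrite (big_ord_widen n (fun i => q`_i *: iter i T v) le_q_n) big_mkcond /=.
apply: eq_bigr => i _; case: ltnP => // le_q_i.
by rewrite nth_default // scale0r.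
Qed.

Lemma poly_act_is_linear T v : linear (poly_act T ^~ v).
Proof.
move=> a p q; pose n := maxn (size p) (size q).
have le_pn : (size p <= n)%N by exact: leq_maxl.
have le_qn : (size q <= n)%N by exact: leq_maxr.
rewrite (poly_act_widen _ _ le_pn) (poly_act_widen _ _ le_qn).
rewrite (@poly_act_widen _ _ _ n); last first.
  rewrite (leq_trans (size_polyD _ _)) // geq_max le_qn andbT.
  exact: leq_trans (size_scale_leq _ _) le_pn.
rewrite scaler_sumr -big_split; apply: eq_bigr => i _.
by rewrite coefD coefZ scalerDl scalerA.
Qed.

Lemma poly_actD T p q v :
  poly_act T (p + q) v = poly_act T p v + poly_act T q v.
Proof. by rewrite -[p]scale1r poly_act_is_linear !scale1r. Qed.

Lemma poly_actB T p q v :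
  poly_act T (p - q) v = poly_act T p v - poly_act T q v.
Proof. exact: (GRing.zmod_morphism_linear (poly_act_is_linear T v)). Qed.

Lemma poly_actZ T a q v : poly_act T (a *: q) v = a *: poly_act T q v.
Proof. exact: (GRing.scalable_linear (poly_act_is_linear T v)). Qed.

Lemma poly_actXn T m v : poly_act T 'X^m v = iter m T v.
Proof.
rewrite /poly_act size_polyXn big_ord_recr /= coefXn eqxx scale1r.
rewrite big1 ?add0r // => i _.
by rewrite coefXn ltn_eqF // scale0r.
Qed.

Lemma poly_actC T a v : poly_act T a%:P v = a *: v.
Proof. by rewrite -alg_polyC poly_actZ -(expr0 'X) poly_actXn. Qed.

Lemma poly_act1 T v : poly_act T 1 v = v.
Proof. by rewrite -(expr0 'X) poly_actXn. Qed.

Lemma poly_actXM_shift T q v : poly_act T ('X * q) v = poly_act T q (T v).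
Proof.
rewrite (@poly_act_widen _ _ _ (size q).+1); last first.
  by rewrite (leq_trans (size_polyMleq _ _)) // size_polyX.
rewrite big_ord_recl coefXM /= scale0r add0r; apply: eq_bigr => i _.
by rewrite coefXM /= -iterS iterSr.
Qed.

Lemma poly_act_is_linear_vec (T : {linear V -> V}) q : linear (poly_act T q).
Proof.
move=> a u v; rewrite /poly_act scaler_sumr -big_split.
apply: eq_bigr => i _ /=.
suff -> : iter i T (a *: u + v) = a *: iter i T u + iter i T v.
  by rewrite scalerDr !scalerA mulrC.
by elim: (nat_of_ord i) => //= j ->; rewrite linearP.
Qed.

Lemma poly_act_vecD (T : {linear V -> V}) q u v :
  poly_act T q (u + v) = poly_act T q u + poly_act T q v.
Proof. by rewrite -[u]scale1r poly_act_is_linear_vec !scale1r. Qed.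

Lemma poly_act_vecZ (T : {linear V -> V}) q a v :
  poly_act T q (a *: v) = a *: poly_act T q v.
Proof. exact: (GRing.scalable_linear (poly_act_is_linear_vec T q)). Qed.

Lemma poly_act_vec0 (T : {linear V -> V}) q : poly_act T q 0 = 0.
Proof. by rewrite -[X in poly_act T q X](scale0r 0) poly_act_vecZ scale0r. Qed.

Lemma poly_actXM (T : {linear V -> V}) q v :
  poly_act T ('X * q) v = T (poly_act T q v).
Proof.
rewrite poly_actXM_shift /poly_act linear_sum; apply: eq_bigr => i _ /=.
by rewrite linearZ /= -iterS iterSr.
Qed.

Lemma poly_actM (T : {linear V -> V}) p q v :
  poly_act T (p * q) v = poly_act T p (poly_act T q v).
Proof.
elim/poly_ind: p => [|p a IHp].
  by rewrite mul0r -polyC0 !poly_actC !scale0r.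
rewrite mulrDl !poly_actD mul_polyC poly_actZ poly_actC [p * 'X]mulrC -mulrA.
by rewrite !poly_actXM IHp.
Qed.

End PolynomialAction.

(** * Jacobi matrices and their moments *)

Section JacobiMatrix.
Variable K : numClosedFieldType.
Variables s b lambda : nat -> K.
Hypothesis sqr_s : forall n, s n ^+ 2 = lambda n.

Local Notation V := (l2fin K).
Local Notation p := (three_term b lambda).

(** The symmetric tridiagonal operator with diagonal [b] and off-diagonal
    entries [s]; the value [s 0] is multiplied by e_(-1) = 0. *)
Definition jacobi : V -> V :=
  linext (fun n => s n.+1 *: e K n.+1 + b n *: e K n + s n *: e_pred K n).

HB.instance Definition _ := GRing.Linear.on jacobi.

Lemma jacobi_e n :
  jacobi (e K n) = s n.+1 *: e K n.+1 + b n *: e K n + s n *: e_pred K n.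
Proof. exact: linext_e. Qed.

Lemma coef_e j n : (e K j)@_n = (j == n)%:R.
Proof. by rewrite /e mcoeffU. Qed.

Lemma inner_e n (v : V) : inner (e K n) v = v@_n.
Proof.
rewrite /inner msuppU oner_eq0 big_seq_fset1.
by rewrite coef_e eqxx conjC1 mul1r.
Qed.

(** s_1 ... s_n, the coefficient of e_n in p_n(T) e_0 *)
Definition s_prod n : K := \prod_(i < n) s i.+1.

Lemma s_prodS n : s_prod n.+1 = s_prod n * s n.+1.
Proof. by rewrite /s_prod big_ord_recr. Qed.

(** The recurrence for [p] is the action of [jacobi] on the basis, rescaled. *)
Lemma poly_act_three_term_e0 n :
  poly_act jacobi (p n) (e K 0) = s_prod n *: e K n.
Proof.
suff [] : poly_act jacobi (p n) (e K 0) = s_prod n *: e K n /\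
          poly_act jacobi (p n.+1) (e K 0) = s_prod n.+1 *: e K n.+1 by [].
elim: n => [|n [IHn IHn1]].
  rewrite poly_act1 poly_actB poly_actC -['X]mulr1 poly_actXM poly_act1.
  rewrite /= jacobi_e /= scaler0 addr0 addrK.
  by rewrite /s_prod big_ord0 big_ord1 scale1r.
split=> //; rewrite three_termSS mulrBl mul_polyC !poly_actB !poly_actZ.
rewrite poly_actXM IHn IHn1 linearZ /= jacobi_e /= !scalerDr !scalerA.
rewrite -sqr_s (s_prodS n.+1) (mulrC (b n.+1)).
have -> : s n.+1 ^+ 2 * s_prod n = s_prod n.+1 * s n.+1.
  by rewrite s_prodS; ring.
by rewrite addrAC addrK addrK.
Qed.

(** Stated for an arbitrary q, so that [three_term] stays folded when it is
    used. *)
Lemma coef_poly_act_jacobi_e q j i :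
  (poly_act jacobi q (jacobi (e K j)))@_i =
    s j.+1 * (poly_act jacobi q (e K j.+1))@_i
    + b j * (poly_act jacobi q (e K j))@_i
    + s j * (poly_act jacobi q (e_pred K j))@_i.
Proof.
rewrite jacobi_e 2!poly_act_vecD 3!poly_act_vecZ.
move: (poly_act _ _ _) (poly_act _ _ _) (poly_act _ _ _) => u v w.
by rewrite !mcoeffD !mcoeffZ.
Qed.

(** This is p_n(T) e_0 = s_1 ... s_n e_n read through the symmetry of T:
    <e_0, p_n(T) e_j> = <p_n(T) e_0, e_j>.  The recurrence proves it directly,
    letting the last factor T of p_(n+1)(T) act on e_j. *)
Lemma poly_act_three_term_coef0 n j :
  (poly_act jacobi (p n) (e K j))@_0 = s_prod n * (j == n)%:R.
Proof.
suff /(_ j) [] : forall j,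
    (poly_act jacobi (p n) (e K j))@_0 = s_prod n * (j == n)%:R /\
    (poly_act jacobi (p n.+1) (e K j))@_0 = s_prod n.+1 * (j == n.+1)%:R
  by [].
elim: n => [|n IHn] {}j.
  rewrite poly_act1 poly_actB poly_actC -['X]mulr1 poly_actXM_shift poly_act1.
  rewrite jacobi_e coef_e /s_prod big_ord0 big_ord1 mul1r; split=> //.
  rewrite mcoeffB !mcoeffD !mcoeffZ !coef_e.
  case: j => [|[|j]] /=; rewrite ?mcoeff0 ?coef_e /=; ring.
split; first by case: (IHn j).
rewrite three_termSS mulrBl mul_polyC !poly_actB !poly_actZ poly_actXM_shift.
rewrite 2!mcoeffB 2!mcoeffZ coef_poly_act_jacobi_e.
have coefn i : (poly_act jacobi (p n) (e K i))@_0 = s_prod n * (i == n)%:R.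
  by case: (IHn i).
have coefSn i :
    (poly_act jacobi (p n.+1) (e K i))@_0 = s_prod n.+1 * (i == n.+1)%:R.
  by case: (IHn i).
have coef_pred : (poly_act jacobi (p n.+1) (e_pred K j))@_0 =
    s_prod n.+1 * (j == n.+2)%:R.
  case: j => [|j]; last exact: coefSn.
  by rewrite [e_pred _ _]/(0 : V) poly_act_vec0 mcoeff0 mulr0.
rewrite coef_pred coefn !coefSn eqSS -sqr_s (s_prodS n.+1) (s_prodS n).
(* Off j = n, n.+1, n.+2 every term vanishes.  At j = n the contribution of
   e_(n+1) cancels against lambda_(n+1), at j = n.+1 the diagonal entry cancels
   against b_(n+1), and j = n.+2 leaves s_1 ... s_(n+2). *)
have [->|_] := eqVneq j n.
  by rewrite !ltn_eqF //=; ring.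
have [->|_] := eqVneq j n.+1.
  by rewrite !ltn_eqF //=; ring.
by have [->|_] := eqVneq j n.+2; rewrite /=; ring.
Qed.

(** L(q) = <e_0, q(T) e_0> for T = [jacobi], read off as the e_0 coordinate *)
Definition jacobi_functional (q : {poly K}) : K :=
  (poly_act jacobi q (e K 0))@_0.

Lemma jacobi_functional_is_scalar : scalar jacobi_functional.
Proof.
move=> a q r; rewrite /jacobi_functional poly_actD poly_actZ.
by rewrite mcoeffD mcoeffZ.
Qed.

HB.instance Definition _ :=
  GRing.isLinear.Build K {poly K} K *%R jacobi_functional
    jacobi_functional_is_scalar.

Lemma jacobi_functional_three_termM m n :
  jacobi_functional (p m * p n) = s_prod m * s_prod n * (m == n)%:R.
Proof.
rewrite /jacobi_functional poly_actM poly_act_three_term_e0 poly_act_vecZ.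
by rewrite mcoeffZ poly_act_three_term_coef0 eq_sym; ring.
Qed.

Lemma matrix_entry_jacobi (T : V -> V) m :
  T =1 jacobi -> matrix_entry T m = jacobi_functional 'X^m.
Proof.
move=> eqT; rewrite /matrix_entry inner_e /jacobi_functional poly_actXn.
by rewrite (eq_iter eqT).
Qed.

Hypothesis s_neq0 : forall n, s n.+1 != 0.

Lemma jacobi_functional_normalized_moment :
  is_normalized_moment_functional p jacobi_functional.
Proof.
split; last first.
  by rewrite /= /jacobi_functional poly_act1 coef_e.
split=> [m n /eqP/negPf neq_mn | n].
  by rewrite /= jacobi_functional_three_termM neq_mn mulr0.
rewrite expr2 /= jacobi_functional_three_termM eqxx mulr1.
apply/eqP; rewrite mulf_neq0 //; apply/prodf_neq0 => i _; exact: s_neq0.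
Qed.

Lemma is_orthogonal_sequence_three_term : is_orthogonal_sequence p.
Proof.
split; first exact: size_three_term.
by exists jacobi_functional; case: jacobi_functional_normalized_moment.
Qed.

Lemma matrix_entry_moment (T : V -> V) (f : {scalar {poly K}}) m :
  T =1 jacobi -> is_normalized_moment_functional p f ->
  matrix_entry T m = f 'X^m.
Proof.
move=> eqT f_mom; rewrite (matrix_entry_jacobi _ eqT).
exact: (normalized_moment_functional_uniq
  (@size_three_term _ _ _) _ jacobi_functional_normalized_moment f_mom).
Qed.

End JacobiMatrix.

(** * The discrete series operators as Jacobi matrices *)

Lemma scaler_swap (F : comNzRingType) (W : lmodType F) (x y z : F) (w : W) :
  x *: (y *: (z *: w)) = y *: ((x * z) *: w).
Proof. by rewrite !scalerA mulrA [x * y]mulrC. Qed.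

Section LoweringRaising.
Variable K : numClosedFieldType.
Variables (s d b s1 : nat -> K) (x : K).
Implicit Type v : l2fin K.

Lemma extend_gensNC (TH TB TC : l2fin K -> l2fin K) v :
  extend_gens TH TB TC (- gC) v = - TC v.
Proof.
rewrite /extend_gens /coefH /Defs.coefB /Defs.coefC !mxE /=.
by rewrite !oppr0 !scale0r !add0r scaleN1r.
Qed.

(** The pattern of the positive series: H is diagonal, C lowers with
    coefficients - s_n and B raises with coefficients s_(n+1). *)
Lemma lowering_raising_jacobi v :
  (forall n, b n = x * d n) -> (forall n, s1 n = s n.+1) ->
  - linext (fun n => - (s n *: e_pred K n)) v
  + x *: linext (fun n => d n *: e K n) v
  + linext (fun n => s1 n *: e K n.+1) v = jacobi s b v.
Proof.
move=> bE s1E; rewrite /jacobi /linext -sumrN scaler_sumr -!big_split /=.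
apply: eq_bigr => n _; rewrite bE s1E.
move: (e K n) (e K n.+1) (e_pred K n) => u u1 u0.
rewrite scalerN opprK scaler_swap 2!scalerDr.
move: (v@_n *: (s n *: u0)) (v@_n *: (s n.+1 *: u1)) => w0 w1.
move: (v@_n *: _) => w.
by rewrite [LHS]addrC [w0 + w]addrC addrA.
Qed.

(** The pattern of the negative series, where B and C exchange roles. *)
Lemma raising_lowering_jacobi v :
  (forall n, b n = - (x * d n)) -> (forall n, s1 n = s n.+1) ->
  - linext (fun n => s1 n *: e K n.+1) v
  + x *: linext (fun n => - (d n *: e K n)) v
  + linext (fun n => - (s n *: e_pred K n)) v =
  jacobi (fun n => - s n) b v.
Proof.
move=> bE s1E; rewrite /jacobi /linext -sumrN scaler_sumr -!big_split /=.
apply: eq_bigr => n _; rewrite bE s1E.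
move: (e K n) (e K n.+1) (e_pred K n) => u u1 u0.
by rewrite 2!scalerDr !scaleNr !scalerN scaler_swap.
Qed.

End LoweringRaising.

Section DiscreteSeriesJacobi.
Variables (R : realType) (k : R).
Hypothesis k_gt0 : 0 < k.

(** The off-diagonal entry of the positive series, a square root of
    lambda_n. *)
Definition offdiag (n : nat) : R[i] :=
  (Num.sqrt (n%:R * (2%:R * k + n%:R - 1)))%:C.

Lemma offdiagS n :
  offdiag n.+1 = (Num.sqrt ((n%:R + 1) * (2%:R * k + n%:R)))%:C.
Proof. by rewrite /offdiag -natr1 addrA addrK. Qed.

Lemma sqr_offdiag n :
  offdiag n ^+ 2 = (n%:R * (n%:R + 2%:R * k - 1))%:C.
Proof.
rewrite /offdiag -rmorphXn /= sqr_sqrtr; first by rewrite [n%:R + _]addrC.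
case: n => [|n]; first by rewrite mul0r.
rewrite -natr1 addrA addrK mulr_ge0 ?addr_ge0 ?mulr_ge0 ?ler0n ?ler01 //.
exact: ltW.
Qed.

Lemma offdiagS_neq0 n : offdiag n.+1 != 0.
Proof.
rewrite offdiagS fmorph_eq0 gt_eqF // sqrtr_gt0.
by apply: mulr_gt0; rewrite ?natr1 ?ltr0Sn ?ltr_pwDl ?mulr_gt0 ?ltr0n ?ler0n.
Qed.

Variable c : R.

Lemma jacobi_op_pos :
  jacobi_op (pi_pos k) c =1
  jacobi offdiag (fun n => (2%:R * c * (k + n%:R))%:C).
Proof.
move=> v; rewrite /jacobi_op /pi_pos extend_gensNC extend_gensH extend_gensB.
apply: lowering_raising_jacobi => n; last by rewrite -offdiagS.
by rewrite -rmorphM /=; congr _%:C; ring.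
Qed.

Lemma jacobi_op_neg :
  jacobi_op (pi_neg k) c =1
  jacobi (fun n => - offdiag n) (fun n => (2%:R * - c * (k + n%:R))%:C).
Proof.
move=> v; rewrite /jacobi_op /pi_neg extend_gensNC extend_gensH extend_gensB.
apply: raising_lowering_jacobi => n; last by rewrite -offdiagS.
by rewrite -rmorphM -rmorphN /=; congr _%:C; ring.
Qed.

End DiscreteSeriesJacobi.

Theorem corollary3p1 (R : realType) (k : R) (hk : 0 < k) (m : nat) (c : R) :
  [/\ is_orthogonal_sequence (pkc k c),
      is_orthogonal_sequence (pkc k (- c)),
      (forall f : {scalar {poly R[i]}},
         is_normalized_moment_functional (pkc k c) f ->
         matrix_entry (jacobi_op (pi_pos k) c) m = f 'X^m) &
      (forall f : {scalar {poly R[i]}},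
         is_normalized_moment_functional (pkc k (- c)) f ->
         matrix_entry (jacobi_op (pi_neg k) c) m = f 'X^m)].
Proof.
have sqr_pos := sqr_offdiag hk; have pos_neq0 := offdiagS_neq0 hk.
have sqr_neg n : (- offdiag k n) ^+ 2 = (n%:R * (n%:R + 2%:R * k - 1))%:C.
  by rewrite sqrrN sqr_pos.
have neg_neq0 n : - offdiag k n.+1 != 0 by rewrite oppr_eq0.
split=> [||f|f].
- exact: is_orthogonal_sequence_three_term sqr_pos pos_neq0.
- exact: is_orthogonal_sequence_three_term sqr_pos pos_neq0.
- exact: matrix_entry_moment sqr_pos pos_neq0 _ _ _ (jacobi_op_pos k c).
- exact: matrix_entry_moment sqr_neg neg_neq0 _ _ _ (jacobi_op_neg k c).
Qed.
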